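(* Let $X\subseteq \mathbb{C}^n$ be an irreducible affine cone. Then \[ X^{*}\subseteq \mathrm{DI}(X)\subseteq X^{*}+(Q\cap X), \] where $X^{*}+(Q\cap X)=\{a+b: a\in X^*,\ b\in Q\cap X\}$.
   Context: Work over $\mathbb{C}^n$ with the standard symmetric bilinear form $(x|y)=\sum_{i=1}^n x_iy_i$, and let $Q=\{x\in\mathbb{C}^n:\sum_{i=1}^n x_i^2=0\}$ be the isotropic quadric. Let $X\subseteq\mathbb{C}^n$ be an irreducible variety of codimension $c$ with radical defining ideal $I$; $\mathrm{Jac}_x(I)$ is the Jacobian matrix of a generating set of $I$ at $x$. $\mathrm{Sing}\,X$ is the set of $x\in X$ at which all $c\times c$ minors of $\mathrm{Jac}_x(I)$ vanish, and $X^{\mathrm{reg}}=X\setminus \mathrm{Sing}\,X$. The ED correspondence $\mathcal{E}_X\subseteq \mathbb{C}^n_u\times\mathbb{C}^n_x$ is the Zariski closure of the set of pairs $(u,x)$ with $u\in\mathbb{C}^n$, $x\in X^{\mathrm{reg}}$ and $\mathrm{rank}\begin{pmatrix}u-x\\ \mathrm{Jac}_x(I)\end{pmatrix}\le c$. Let $\pi_1,\pi_2$ be the projections of $\mathcal{E}_X$ to the $u$- and $x$-coordinates. The ED data isotropic locus is $\mathrm{DI}(X)=\pi_1(\mathcal{E}_X\cap\pi_2^{-1}(Q\cap X))$. The dual variety $X^{*}\subseteq\mathbb{C}^n$ is the Zariski closure of the set of $u\in\mathbb{C}^n$ such that $(u|v)=0$ for all $v\in T_xX$ for some $x\in X^{\mathrm{reg}}$.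 An affine cone is a variety stable under scaling, i.e. defined by homogeneous polynomials. *)

(* Defs.v *)
From HB Require Import structures.
From mathcomp Require Import all_boot all_order all_algebra.
From mathcomp Require Import mpoly.
From mathcomp Require Import complex.
From mathcomp Require Import reals.

Set Implicit Arguments.
Unset Strict Implicit.
Unset Printing Implicit Defensive.

Import GRing.Theory.
Local Open Scope ring_scope.

Section AffineGeometry.
Variable C : fieldType.

Definition pt (n : nat) := 'I_n -> C.

Section Closure.
Variable n : nat.

Definition vanishes (S : pt n -> Prop) (p : {mpoly C[n]}) : Prop :=
  forall x, S x -> p.@[x] = 0.

Definition zclosure (S : pt n -> Prop) : pt n -> Prop :=
  fun x => forall p, vanishes S p -> p.@[x] = 0.

End Closure.

Section Fixed_n.
Variable n : nat.

Definition zclosed (S : pt n -> Prop) : Prop :=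
  forall x, zclosure S x -> S x.

Definition zirreducible (S : pt n -> Prop) : Prop :=
  [/\ zclosed S, exists x, S x &
      forall A B : pt n -> Prop, zclosed A -> zclosed B ->
        (forall x, S x -> A x \/ B x) ->
        (forall x, S x -> A x) \/ (forall x, S x -> B x)].

Definition irr_chain (S : pt n -> Prop) (d : nat) : Prop :=
  exists Z : nat -> pt n -> Prop,
    [/\ forall i, (i <= d)%N -> zirreducible (Z i),
        forall i, (i < d)%N ->
          (forall x, Z i x -> Z i.+1 x) /\ exists x, Z i.+1 x /\ ~ Z i x
      & forall x, Z d x -> S x].

Definition zdim (S : pt n -> Prop) (d : nat) : Prop :=
  irr_chain S d /\ ~ irr_chain S d.+1.

Definition zcodim (S : pt n -> Prop) (c : nat) : Prop :=
  exists d, zdim S d /\ (d + c)%N = n.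

Definition affine_cone (S : pt n -> Prop) : Prop :=
  forall (t : C) x, S x -> S (fun i => t * x i).

Definition generates_ideal (gens : seq {mpoly C[n]}) (X : pt n -> Prop) : Prop :=
  forall f, vanishes X f <->
    exists a : 'I_(size gens) -> {mpoly C[n]},
      f = \sum_(i < size gens) a i * gens`_i.

Definition jac (gens : seq {mpoly C[n]}) (x : pt n) : 'M[C]_(size gens, n) :=
  \matrix_(i < size gens, j < n) (mderiv j gens`_i).@[x].

(* Sing X: points of X where all c x c minors of Jac vanish, i.e. rank < c *)
Definition sing (X : pt n -> Prop) (gens : seq {mpoly C[n]}) (c : nat)
  (x : pt n) : Prop := X x /\ (\rank (jac gens x) < c)%N.

Definition reg (X : pt n -> Prop) (gens : seq {mpoly C[n]}) (c : nat)
  (x : pt n) : Prop := X x /\ ~ sing X gens c x.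

Definition isotropic (x : pt n) : Prop := \sum_(i < n) x i ^+ 2 = 0.

Definition bform (x y : pt n) : C := \sum_(i < n) x i * y i.

Definition tangent (X : pt n -> Prop) (x v : pt n) : Prop :=
  forall f, vanishes X f -> \sum_(i < n) (mderiv i f).@[x] * v i = 0.

Definition dual_variety (X : pt n -> Prop) (gens : seq {mpoly C[n]}) (c : nat)
  : pt n -> Prop :=
  zclosure (fun u => exists x, reg X gens c x /\
                       forall v, tangent X x v -> bform u v = 0).

Definition join_pt (u x : pt n) : pt (n + n) :=
  fun i => match split i with inl j => u j | inr j => x j end.

Definition ed_pair (X : pt n -> Prop) (gens : seq {mpoly C[n]}) (c : nat)
  (u x : pt n) : Prop :=
  reg X gens c x /\
  (\rank (col_mx (\row_(j < n) (u j - x j)%R) (jac gens x)) <= c)%N.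

Definition ed_corr (X : pt n -> Prop) (gens : seq {mpoly C[n]}) (c : nat)
  (u x : pt n) : Prop :=
  @zclosure (n + n) (fun z => exists u' x', z = join_pt u' x' /\ ed_pair X gens c u' x')
           (join_pt u x).

Definition ed_isotropic_locus (X : pt n -> Prop) (gens : seq {mpoly C[n]})
  (c : nat) (u : pt n) : Prop :=
  exists x, [/\ X x, isotropic x & ed_corr X gens c u x].

End Fixed_n.
End AffineGeometry.

(* Main.v *)
(** If [(u, x)] lies in the ED correspondence then [u - x] lies in [X^*], because
    over regular points [u - x] is conormal and this is a closed condition; this
    gives the second inclusion. For the first one, let [w] be conormal at the
    regular point [y]. As [X] is a cone, [w] is also conormal at [t y], so
    [(w + t y, t y)] is an ED pair for [t <> 0]; letting [t] tend to [0] puts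
    [(w, 0)] in the correspondence, and [0] is an isotropic point of [X].

    The last step needs that the Jacobian has rank at most [c] on [X]. Given a
    chain [Z_0 < ... < Z_d] in [X], pick [f_i] vanishing on [Z_i] but not on
    [Z_(i+1)]. In the field [L] of rational functions on [X], each [f_i] is
    transcendental over [C[f_0, ..., f_(i-1)]], so there are derivations [D_j] of
    this ring with [D_j f_i = delta_ij]. In characteristic 0 they extend to
    [C[X]], and their values at the coordinates form a matrix of rank [d] that
    the Jacobian over [L] annihilates. *)

Require Import Defs.
From HB Require Import structures.
From mathcomp Require Import all_boot all_order all_algebra.
From mathcomp Require Import ring_quotient boolp.
From mathcomp Require Import mpoly.
From mathcomp Require Import complex.
From mathcomp Require Import reals ring zify.

Set Implicit Arguments.
Unset Strict Implicit.
Unset Printing Implicit Defensive.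

Import Order.TTheory GRing.Theory Num.Theory.
Local Open Scope ring_scope.

(** * The residue field of a prime ideal, as fractions of the quotient ring *)

Section PrimeResidueField.
Variables (A : comNzRingType) (I : A -> Prop).
Hypotheses (I0 : I 0) (I1 : ~ I 1) (ID : forall a b, I a -> I b -> I (a + b))
  (IM : forall a b, I b -> I (a * b))
  (Iprime : forall a b, I (a * b) -> I a \/ I b).

Definition idealb : {pred A} := fun a => `[< I a >].

Fact idealb_idealr_closed : idealr_closed idealb.
Proof.
split; [exact/asboolP | exact/asboolP |].
move=> a u v /asboolP Iu /asboolP Iv.
by apply/asboolP/ID => //; apply: IM.
Qed.
HB.instance Definition _ := isIdealr.Build A idealb idealb_idealr_closed.

Fact idealb_prime_closed : prime_idealr_closed idealb.
Proof.
move=> u v /asboolP/Iprime[?|?]; apply/orP.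
  by left; apply/asboolP.
by right; apply/asboolP.
Qed.
HB.instance Definition _ := isPrimeIdealrClosed.Build A idealb idealb_prime_closed.

Definition residue_ring : Type := Quotient.quot idealb.
HB.instance Definition _ := GRing.ComNzRing.on residue_ring.

(** Units and inverses are chosen classically, only to equip the quotient with the integral domain
    structure over which fractions are formed. *)
Definition residue_unit : {pred residue_ring} :=
  fun x => `[< exists y, y * x = 1 >].
Definition residue_inv (x : residue_ring) : residue_ring :=
  if pselect (exists y, y * x = 1) is left h then projT1 (cid h) else x.

Fact residue_mulVx : {in residue_unit, left_inverse 1 residue_inv *%R}.
Proof.
move=> x /asboolP hx; rewrite /residue_inv; case: pselect => // h.
by case: cid.
Qed.
Fact residue_unitPl x y : y * x = 1 -> residue_unit x.
Proof. by move=> h; apply/asboolP; exists y. Qed.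
Fact residue_inv_out : {in [predC residue_unit], residue_inv =1 id}.
Proof.
move=> x /negP hx; rewrite /residue_inv; case: pselect => // h.
by case: hx; apply/asboolP.
Qed.
HB.instance Definition _ := GRing.ComNzRing_hasMulInverse.Build residue_ring
  residue_mulVx residue_unitPl residue_inv_out.
HB.instance Definition _ := GRing.ComUnitRing_isIntegral.Build residue_ring
  (@Quotient.rquot_IdomainAxiom A idealb).

Lemma residue_field : exists (L : fieldType) (pr : {rmorphism A -> L}),
  forall a, pr a = 0 <-> I a.
Proof.
pose f : A -> {fraction residue_ring} :=
  @FracField.tofrac residue_ring \o (\pi_residue_ring)%qT.
exists {fraction residue_ring}.
exists (GRing.RMorphism.clone _ _ f _) => a.
have -> : f a = 0 <-> (f a == 0) by split=> /eqP.
rewrite /f /= tofrac_eq0.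
have -> : (0 : residue_ring) = (\pi_residue_ring 0)%qT by rewrite rmorph0.
rewrite -Quotient.idealrBE subr0.
by split=> /asboolP.
Qed.

End PrimeResidueField.

(** * Derivations on subrings of a field and their extension to simple extensions *)

Section DerivationExtension.
Variable L : fieldType.
Implicit Types (S : L -> Prop) (D : L -> L) (x w : L) (p q : {poly L}).

Definition is_subring S : Prop :=
  [/\ S 1, forall a b, S a -> S b -> S (a - b)
         & forall a b, S a -> S b -> S (a * b)].

Definition derivation_on S D : Prop :=
  [/\ is_subring S, forall a b, S a -> S b -> D (a + b) = D a + D b
         & forall a b, S a -> S b -> D (a * b) = D a * b + a * D b].

Definition coefs_in S p : Prop := forall i, S p`_i.

Definition adjoin S x : L -> Prop :=
  fun z => exists2 p, coefs_in S p & z = p.[x].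

(* The value at [x] of the derivation of [S[X]] that extends [D] and sends [X]
   to [w]. *)
Definition deriv_at D x w p : L := (map_poly D p).[x] + p^`().[x] * w.

Section Subring.
Variable S : L -> Prop.
Hypothesis subS : is_subring S.

Lemma subring1 : S 1. Proof. by case: subS. Qed.
Lemma subringB a b : S a -> S b -> S (a - b).
Proof. by case: subS => _ + _; apply. Qed.
Lemma subringM a b : S a -> S b -> S (a * b).
Proof. by case: subS => _ _; apply. Qed.
Lemma subring0 : S 0.
Proof. by rewrite -(subrr 1); apply: subringB; apply: subring1. Qed.
Lemma subringN a : S a -> S (- a).
Proof. by rewrite -sub0r; apply: subringB; apply: subring0. Qed.
Lemma subringD a b : S a -> S b -> S (a + b).
Proof. by move=> Sa Sb; rewrite -[b]opprK; apply/subringB/subringN. Qed.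
Lemma subring_sum (J : Type) (r : seq J) (P : pred J) (F : J -> L) :
  (forall j, S (F j)) -> S (\sum_(j <- r | P j) F j).
Proof.
by move=> SF; elim/big_ind: _ => //; [apply: subring0|apply: subringD].
Qed.

Lemma coefs_inC a : S a -> coefs_in S a%:P.
Proof. by move=> Sa i; rewrite coefC; case: eqP => // _; apply: subring0. Qed.
Lemma coefs_inX : coefs_in S 'X.
Proof.
by move=> i; rewrite coefX; case: eqP => _; [apply: subring1|apply: subring0].
Qed.
Lemma coefs_inB p q : coefs_in S p -> coefs_in S q -> coefs_in S (p - q).
Proof. by move=> Sp Sq i; rewrite coefB; apply: subringB. Qed.
Lemma coefs_inM p q : coefs_in S p -> coefs_in S q -> coefs_in S (p * q).
Proof.
by move=> Sp Sq i; rewrite coefM; apply: subring_sum => j; apply: subringM.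
Qed.
Lemma coefs_in_deriv p : coefs_in S p -> coefs_in S p^`().
Proof.
move=> Sp i; rewrite coef_deriv -mulr_natr; apply: subringM => //.
by elim: i.+1 => [|k Sk]; [apply: subring0|rewrite -addn1 natrD;
  apply: subringD => //; apply: subring1].
Qed.

Lemma subring_adjoin x : is_subring (adjoin S x).
Proof.
split.
- by exists 1%:P; [apply/coefs_inC/subring1|rewrite hornerC].
- move=> _ _ [p Sp ->] [q Sq ->]; exists (p - q); first exact: coefs_inB.
  by rewrite !hornerE.
- move=> _ _ [p Sp ->] [q Sq ->]; exists (p * q); first exact: coefs_inM.
  by rewrite hornerM.
Qed.

Lemma sub_adjoin x a : S a -> adjoin S x a.
Proof. by exists a%:P; [apply: coefs_inC|rewrite hornerC]. Qed.

Lemma mem_adjoin x : adjoin S x x.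
Proof. by exists 'X; [apply: coefs_inX|rewrite hornerX]. Qed.

End Subring.

Section Extension.
Variables (S : L -> Prop) (D : L -> L).
Hypothesis derD : derivation_on S D.

Let subS : is_subring S. Proof. by case: derD. Qed.

Lemma derivationD a b : S a -> S b -> D (a + b) = D a + D b.
Proof. by case: derD => _ + _; apply. Qed.
Lemma derivationM a b : S a -> S b -> D (a * b) = D a * b + a * D b.
Proof. by case: derD => _ _; apply. Qed.
Lemma derivation0 : D 0 = 0.
Proof.
have S0 := subring0 subS; apply: (addrI (D 0)).
by rewrite -derivationD // !addr0.
Qed.
Lemma derivation1 : D 1 = 0.
Proof.
have S1 := subring1 subS; apply: (addrI (D 1)).
by rewrite addr0 -[in RHS](mulr1 1) derivationM // mulr1 mul1r.
Qed.
Lemma derivationB a b : S a -> S b -> D (a - b) = D a - D b.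
Proof.
move=> Sa Sb; apply: (addIr (D b)); rewrite subrK -derivationD ?subrK //.
exact: subringB.
Qed.
Lemma derivation_sum (J : Type) (r : seq J) (F : J -> L) :
  (forall j, S (F j)) -> D (\sum_(j <- r) F j) = \sum_(j <- r) D (F j).
Proof.
move=> SF; elim: r => [|j r IH]; first by rewrite !big_nil derivation0.
by rewrite !big_cons derivationD ?IH //; apply: subring_sum.
Qed.

Lemma map_derivationB p q : coefs_in S p -> coefs_in S q ->
  map_poly D (p - q) = map_poly D p - map_poly D q.
Proof.
move=> Sp Sq; apply/polyP => i.
by rewrite coefB !coef_map_id0 ?derivation0 // coefB derivationB.
Qed.

Lemma map_derivationM p q : coefs_in S p -> coefs_in S q ->
  map_poly D (p * q) = map_poly D p * q + p * map_poly D q.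
Proof.
move=> Sp Sq; apply/polyP => i.
rewrite coefD coef_map_id0 ?derivation0 // !coefM -big_split /=.
rewrite derivation_sum => [|j]; last exact: subringM.
by apply: eq_bigr => j _; rewrite derivationM // !coef_map_id0 ?derivation0.
Qed.

Variables x w : L.

Lemma deriv_at0 : deriv_at D x w 0 = 0.
Proof. by rewrite /deriv_at map_poly0 deriv0 !horner0 mul0r addr0. Qed.

Lemma deriv_atC a : deriv_at D x w a%:P = D a.
Proof.
rewrite /deriv_at derivC horner0 mul0r addr0 -[RHS](hornerC _ x).
congr _.[x]; apply/polyP => i; rewrite coef_map_id0 ?derivation0 // !coefC.
by case: eqP => _ //; apply: derivation0.
Qed.

Lemma deriv_atX : deriv_at D x w 'X = w.
Proof.
rewrite /deriv_at derivX hornerC mul1r (_ : map_poly D 'X = 0) ?horner0 ?add0r //.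
apply/polyP => i; rewrite coef_map_id0 ?derivation0 // coefX coef0.
by case: eqP => _; rewrite ?derivation0 ?derivation1.
Qed.

Lemma deriv_atB p q : coefs_in S p -> coefs_in S q ->
  deriv_at D x w (p - q) = deriv_at D x w p - deriv_at D x w q.
Proof.
move=> Sp Sq; rewrite /deriv_at map_derivationB // derivB !hornerE.
by rewrite mulrBl opprD addrACA.
Qed.

Lemma deriv_atM p q : coefs_in S p -> coefs_in S q ->
  deriv_at D x w (p * q) = deriv_at D x w p * q.[x] + p.[x] * deriv_at D x w q.
Proof.
move=> Sp Sq; rewrite /deriv_at map_derivationM // derivM !hornerE /=.
by ring.
Qed.

(* An extension to [S[x]] amounts to a value [w] at [x] that respects the
   polynomial relations of [x] over [S]. *)
Lemma derivation_adjoin :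
  (forall p, coefs_in S p -> p.[x] = 0 -> deriv_at D x w p = 0) ->
  exists D', [/\ derivation_on (adjoin S x) D', forall a, S a -> D' a = D a
                & D' x = w].
Proof.
move=> relS.
(* Off [S[x]] the value is the default 0. On [S[x]] an arbitrary representing polynomial is chosen;
   [relS], applied to a difference of two representatives, makes the choice irrelevant. *)
pose D' z := if pselect (adjoin S x z) is left h
             then deriv_at D x w (projT1 (cid2 h)) else 0.
have D'E p : coefs_in S p -> D' p.[x] = deriv_at D x w p.
  move=> Sp; rewrite /D'; case: pselect => [h|[]]; last by exists p.
  case: cid2 => q Sq /= e; apply/eqP; rewrite -subr_eq0 -deriv_atB //.
  by apply/eqP/relS; [apply: coefs_inB|rewrite !hornerE e subrr].
have D'B a b : adjoin S x a -> adjoin S x b -> D' (a - b) = D' a - D' b.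
  move=> [p Sp ->] [q Sq ->]; rewrite -hornerN -hornerD !D'E //.
    exact: deriv_atB.
  exact: coefs_inB.
have subS' := subring_adjoin subS x.
exists D'; split.
- split=> // a b Sa Sb.
    have -> : D' a = D' (a + b) - D' b.
      by rewrite -D'B ?addrK //; apply: subringD.
    by rewrite subrK.
  case: Sa Sb => [p Sp ->] [q Sq ->]; rewrite -hornerM !D'E //.
    exact: deriv_atM.
  exact: coefs_inM.
- by move=> a Sa; rewrite -(deriv_atC a) -D'E ?hornerC //; apply: coefs_inC.
- by rewrite -deriv_atX -D'E ?hornerX //; apply: coefs_inX.
Qed.

End Extension.

Lemma derivation_adjoin_transcendental S D x w : derivation_on S D ->
  (forall p, coefs_in S p -> p.[x] = 0 -> p = 0) ->
  exists D', [/\ derivation_on (adjoin S x) D', forall a, S a -> D' a = D a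
                & D' x = w].
Proof.
move=> derD trx; apply: derivation_adjoin => // p Sp /(trx p Sp) ->.
exact: deriv_at0.
Qed.

(* For [x] algebraic, the value at [x] is dictated by a nonzero relation of
   minimal degree, which is separable in characteristic 0. *)
Lemma derivation_adjoin_char0 S D x : [pchar L] =i pred0 ->
  derivation_on S D ->
  exists D', derivation_on (adjoin S x) D' /\ forall a, S a -> D' a = D a.
Proof.
move=> ch0 derD; have [subS _ _] := derD.
have [[p [Sp px0 pn0]]|trx] :=
  pselect (exists p, [/\ coefs_in S p, p.[x] = 0 & p != 0]); last first.
  have [|D' [? ? _]] := @derivation_adjoin_transcendental S D x 0 derD.
    by move=> p Sp px0; apply/eqP/negPn/negP => pn0; apply: trx; exists p.
  by exists D'.
pose Q k := `[< exists p, [/\ coefs_in S p, p.[x] = 0, p != 0 & size p = k] >].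
have exQ : exists k, Q k by exists (size p); apply/asboolP; exists p.
case: (ex_minnP exQ) => k /asboolP[{Sp px0 pn0}p [Sp px0 pn0 sp]] mink.
have {mink}minp q : coefs_in S q -> q.[x] = 0 -> (size q < size p)%N -> q = 0.
  move=> Sq qx0 lt_qp; apply/eqP/negPn/negP => qn0.
  have : (k <= size q)%N by apply: mink; apply/asboolP; exists q.
  by rewrite leqNgt -sp lt_qp.
have sp1 : (1 < size p)%N.
  rewrite ltnNge; apply/negP => /size1_polyC pE; case/negP: pn0.
  by rewrite pE -(hornerC p`_0 x) -pE px0.
have p'x : p^`().[x] != 0.
  apply/eqP => p'x0; have := minp _ (coefs_in_deriv subS Sp) p'x0 (lt_size_deriv pn0).
  move=> /polyP/(_ (size p).-2).
  rewrite coef_deriv coef0 -mulr_natr => /eqP.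
  rewrite mulf_eq0 (pcharf0P _).1 // orbF prednK; last by case: size sp1 => [|[]].
  by rewrite -/(lead_coef p) lead_coef_eq0 (negPf pn0).
(* The only value at [x] for which the relation [p] is respected. *)
pose w := - (map_poly D p).[x] / p^`().[x].
have Ep : deriv_at D x w p = 0.
  by rewrite /deriv_at /w mulrC divfK // subrr.
have [|D' [? ? _]] := @derivation_adjoin S D derD x w; last by exists D'.
move=> q; have [m] := ubnP (size q); elim: m q => // m IH q /ltnSE le_qm Sq qx0.
have [lt_qp|le_pq] := ltnP (size q) (size p).
  by rewrite (minp q) // deriv_at0.
(* One step of pseudo-division: [S] need not contain inverses, so [q] is multiplied by [a] before
   its top term is cancelled. As [p] and [q] vanish at [x], [deriv_at] of [r] is [a] times that of
   [q]. *)
pose a := lead_coef p; pose t := (lead_coef q)%:P * 'X^(size q - size p).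
pose r := a%:P * q - t * p.
have Sa : coefs_in S a%:P by apply: (coefs_inC subS); apply: Sp.
have St : coefs_in S t.
  apply: (coefs_inM subS); first exact: (coefs_inC subS (Sq _)).
  elim: (_ - _)%N => [|i Si].
    by rewrite expr0 -polyC1; apply: (coefs_inC subS); apply: subring1.
  by rewrite exprS; apply: coefs_inM => //; apply: coefs_inX.
have rx0 : r.[x] = 0 by rewrite !hornerE px0 qx0 !mulr0 subrr.
have : deriv_at D x w r = 0.
  apply: IH => //; last by apply: coefs_inB => //; apply: coefs_inM.
  have q_gt0 : (0 < size q)%N by apply: leq_trans le_pq; apply: ltnW.
  apply: leq_trans le_qm; rewrite -(prednK q_gt0) ltnS.
  apply/leq_sizeP => j le_qj; rewrite coefB /t -mulrA !coefCM coefXnM.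
  have -> : (j < size q - size p)%N = false by apply/negbTE; lia.
  have [->|ne_j] := eqVneq j (size q).-1.
    rewrite (_ : _ - _ = (size p).-1)%N; last by lia.
    by rewrite -!/(lead_coef _) mulrC subrr.
  have lt_qj : (size q <= j)%N.
    by rewrite -(prednK q_gt0) ltn_neqAle eq_sym ne_j.
  rewrite !nth_default ?mulr0 ?subrr //.
  by apply: leq_trans (leq_sub2r _ lt_qj); rewrite subKn.
clearbody t.
rewrite (deriv_atB derD) ?(deriv_atM derD) //; try exact: (coefs_inM subS).
rewrite qx0 px0 Ep !mulr0 !addr0 subr0 hornerC add0r => /eqP.
by rewrite mulf_eq0 lead_coef_eq0 (negPf pn0) => /eqP.
Qed.

End DerivationExtension.

(** * Derivations on the image of a polynomial ring *)

Lemma mnmBB n (m : 'X_{1..n}) : (m - m)%MM = 0%MM.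
Proof. by rewrite -{1}[m]add0m addmK. Qed.

Lemma mpoly_ring_ind (R : nzRingType) n (P : {mpoly R[n]} -> Prop) :
  (forall c, P c%:MP) -> (forall i, P 'X_i) ->
  (forall p q, P p -> P q -> P (p + q)) ->
  (forall p q, P p -> P q -> P (p * q)) ->
  forall p, P p.
Proof.
move=> PC PX PD PM p; rewrite [p]mpolyE; elim/big_ind: _ => //.
  by rewrite -mpolyC0.
move=> m _; rewrite -mul_mpolyC; apply: (PM) => //.
have P1 : P 1 by rewrite -mpolyC1.
rewrite mpolyXE_id; apply: (big_ind P) => // i _.
elim: (m i) => [|k IH]; first by rewrite expr0.
by rewrite exprS; apply: PM.
Qed.

Section DerivationMpoly.
Variables (C L : fieldType) (n : nat) (pr : {rmorphism {mpoly C[n]} -> L}).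

(** The chain rule: both sides obey the sum and product rules in [g] and agree on constants and
    variables. *)
Lemma derivation_mpoly S D : derivation_on S D ->
  (forall c, S (pr c%:MP) /\ D (pr c%:MP) = 0) -> (forall i, S (pr 'X_i)) ->
  forall g, S (pr g) /\
    D (pr g) = \sum_(i < n) pr (mderiv i g) * D (pr 'X_i).
Proof.
move=> derD SC SX; have [subS _ _] := derD; elim/mpoly_ring_ind.
- move=> c; have [? ->] := SC c; split=> //.
  by rewrite big1 // => i _; rewrite mderivC rmorph0 mul0r.
- move=> i; split=> //; rewrite (bigD1 i) //= big1 => [|j ne_ji].
    by rewrite mderivX mnm1E eqxx mnmBB mpolyX0 scale1r rmorph1 mul1r addr0.
  by rewrite mderivX mnm1E eq_sym (negPf ne_ji) scale0r rmorph0 mul0r.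
- move=> p q [Sp Dp] [Sq Dq]; rewrite rmorphD.
  split; first exact: (subringD subS).
  rewrite (derivationD derD) // Dp Dq -big_split /=.
  by apply: eq_bigr => i _; rewrite mderivD rmorphD mulrDl.
- move=> p q [Sp Dp] [Sq Dq]; rewrite rmorphM.
  split; first exact: (subringM subS).
  rewrite (derivationM derD) // Dp Dq mulr_suml mulr_sumr -big_split /=.
  apply: eq_bigr => i _; rewrite mderivM rmorphD !rmorphM.
  by ring.
Qed.

Lemma derivation_adjoin_seq (S : L -> Prop) D (s : seq L) : [pchar L] =i pred0 ->
  derivation_on S D ->
  exists S' D', [/\ derivation_on S' D', forall a, S a -> S' a /\ D' a = D a
                  & forall z, z \in s -> S' z].
Proof.
move=> ch0 derD; elim: s => [|x s [S1 [D1 [der1 ext1 mem1]]]]; first by exists S, D.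
have [sub1 _ _] := der1.
have [D2 [der2 ext2]] := derivation_adjoin_char0 x ch0 der1.
exists (adjoin S1 x), D2; split=> // [a /ext1[S1a <-]|z].
  by split; [apply: sub_adjoin|apply: ext2].
rewrite inE => /predU1P[->|/mem1 S1z]; first exact: mem_adjoin.
exact: sub_adjoin.
Qed.

End DerivationMpoly.

(** Rank can only drop under specialization: a maximal square submatrix, cut out by rows [f] and
    columns [g], has nonzero determinant under [ev], hence also under [pr]. *)
Lemma mxrank_map_le (A : comNzRingType) (F L : fieldType)
    (ev : {rmorphism A -> F}) (pr : {rmorphism A -> L}) m n (G : 'M[A]_(m, n)) :
  (forall a, pr a = 0 -> ev a = 0) ->
  (\rank (map_mx ev G) <= \rank (map_mx pr G))%N.
Proof.
move=> ker; set M := map_mx ev G.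
have free_f := maxrowsub_free M; set f := maxrankfun M in free_f.
have full_g : row_full (rowsub f M)^T by rewrite /row_full mxrank_tr.
pose g := fullrankfun full_g.
have : mxsub f g M \in unitmx.
  rewrite -unitmx_tr -row_full_unit.
  suff -> : (mxsub f g M)^T = rowsub g (rowsub f M)^T by apply: fullrowsub_full.
  by apply/matrixP => i j; rewrite !mxE.
rewrite unitmxE unitfE -map_mxsub det_map_mx => ev_neq0.
have : mxsub f g (map_mx pr G) \in unitmx.
  rewrite unitmxE unitfE -map_mxsub det_map_mx.
  by apply: contra ev_neq0 => /eqP/ker/eqP.
move=> /mxrank_unit <-; rewrite -mxrank_tr.
have -> : (mxsub f g (map_mx pr G))^T = rowsub g (rowsub f (map_mx pr G))^T.
  by apply/matrixP => i j; rewrite !mxE.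
apply: leq_trans (mxrankS (rowsub_sub _ _)) _.
by rewrite mxrank_tr mxrankS // rowsub_sub.
Qed.

(** * Irreducible sets and their function fields *)

Section Irreducible.
Variables (C : fieldType) (n : nat).
Implicit Types (X Y Z : pt C n -> Prop) (p q : {mpoly C[n]}).

Lemma zclosed_zero_locus p : zclosed (fun x => p.@[x] = 0).
Proof. by move=> x; apply. Qed.

(** The zero loci of [p] and [q] are closed and together cover [X], so one of them contains it. *)
Lemma zirreducible_prime X p q : zirreducible X ->
  vanishes X (p * q) -> vanishes X p \/ vanishes X q.
Proof.
case=> _ _ irrX pq0.
have := irrX _ _ (@zclosed_zero_locus p) (@zclosed_zero_locus q).
apply=> x /pq0 /eqP; rewrite mevalM mulf_eq0.
by case/orP => /eqP; [left|right].
Qed.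

Lemma function_field X : zirreducible X ->
  exists (L : fieldType) (pr : {rmorphism {mpoly C[n]} -> L}),
    forall p, pr p = 0 <-> vanishes X p.
Proof.
move=> irrX; apply: residue_field.
- by move=> x _; rewrite meval0.
- case: irrX => _ [x Xx] _ /(_ x Xx)/eqP.
  by rewrite meval1 oner_eq0.
- by move=> p q p0 q0 x Xx; rewrite mevalD p0 ?q0 ?addr0.
- by move=> p q q0 x Xx; rewrite mevalM q0 ?mulr0.
- by move=> p q; apply: zirreducible_prime.
Qed.

Lemma proper_subset_separated Y Z x : zclosed Y -> Z x -> ~ Y x ->
  exists f, vanishes Y f /\ ~ vanishes Z f.
Proof.
move=> clY Zx nYx; apply: contrapT => nf; apply/nYx/clY => f f0.
by apply: contrapT => fx; apply: nf; exists f; split=> // /(_ x Zx).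
Qed.

End Irreducible.

(** * A chain of irreducible subsets bounds the rank of the generic Jacobian *)

Section Chain.
Variables (C : fieldType) (n : nat) (X : pt C n -> Prop) (d : nat).
Variables (Z : nat -> pt C n -> Prop) (f : nat -> {mpoly C[n]}).
Hypothesis irrX : zirreducible X.
Hypothesis irrZ : forall i, (i <= d)%N -> zirreducible (Z i).
Hypothesis ZS : forall i, (i < d)%N -> forall x, Z i x -> Z i.+1 x.
Hypothesis ZX : forall x, Z d x -> X x.
Hypothesis f0 : forall i, (i < d)%N -> vanishes (Z i) (f i).
Hypothesis fn0 : forall i, (i < d)%N -> ~ vanishes (Z i.+1) (f i).
Variables (L : fieldType) (pr : {rmorphism {mpoly C[n]} -> L}).
Hypothesis kerE : forall p, pr p = 0 <-> vanishes X p.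

Lemma chain_subset i : (i <= d)%N -> forall x, Z i x -> X x.
Proof.
move=> /subnK; move: (d - i)%N => k; elim: k i => [|k IH] i; first by rewrite add0n => ->.
rewrite addSnnS => e x Zx; apply: (IH i.+1) => //; apply: ZS => //.
by rewrite -e leq_addl.
Qed.

(** The ring [C[f_0, ..., f_(i-1)]] inside [L], built by simple extensions so that derivations
    extend one step at a time. *)
Fixpoint chain_ring i : L -> Prop :=
  if i is i'.+1 then adjoin (chain_ring i') (pr (f i'))
  else fun z => exists c, z = pr c%:MP.

Lemma chain_ring_subring i : is_subring (chain_ring i).
Proof.
elim: i => [|i IH] /=; last exact: subring_adjoin.
split; first by exists 1; rewrite mpolyC1 rmorph1.
- by move=> _ _ [a ->] [b ->]; exists (a - b); rewrite mpolyCB rmorphB.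
- by move=> _ _ [a ->] [b ->]; exists (a * b); rewrite mpolyCM rmorphM.
Qed.

(** Elements of [L] cannot be evaluated at points; lifting the coefficients to polynomials lets a
    relation be restricted to the sets [Z i]. *)
Lemma coefs_in_lift (S : L -> Prop) (p : {poly L}) :
  (forall z, S z -> exists a, z = pr a) -> coefs_in S p ->
  exists P : {poly {mpoly C[n]}}, p = map_poly pr P.
Proof.
move=> lift Sp; have [a aE] := choice (fun i => lift _ (Sp i)).
exists (\poly_(i < size p) a i); apply/polyP => i.
rewrite coef_map coef_poly; case: ltnP => [_|le_pi]; first exact: aE.
by rewrite raddf0 nth_default.
Qed.

Lemma chain_ring_lift i z : chain_ring i z -> exists a, z = pr a.
Proof.
elim: i z => [|i IH] z /=; first by case=> c ->; exists c%:MP.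
case=> p /(coefs_in_lift IH)[P ->] ->.
by exists P.[f i]; rewrite horner_map.
Qed.

(** Injectivity of the restriction of [C[f_0, ..., f_(i-1)]] to [Z i], phrased through polynomial
    representatives. *)
Definition chain_faithful i :=
  forall a, chain_ring i (pr a) -> vanishes (Z i) a -> pr a = 0.

(* Restricting the relation to [Z_i], where [f_i] vanishes, kills its constant
   term; the remaining ones are divisible by [f_i], which [Z_(i+1)] lets cancel. *)
Lemma chain_relation_trivial i (P : {poly {mpoly C[n]}}) : (i < d)%N ->
  chain_faithful i -> coefs_in (chain_ring i) (map_poly pr P) ->
  vanishes (Z i.+1) P.[f i] -> map_poly pr P = 0.
Proof.
move=> lt_id faith; elim/poly_ind: P => [|P c IH SP PZ]; first by rewrite map_poly0.
have c0 : pr c = 0.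
  apply: faith => [|x Zx].
    by have := SP 0; rewrite coef_map coefD coefMX coefC add0r.
  have := PZ x (ZS lt_id Zx).
  by rewrite !hornerE mevalD mevalM f0 // mulr0 add0r.
have PE : map_poly pr (P * 'X + c%:P) = map_poly pr P * 'X.
  by rewrite rmorphD rmorphM /= map_polyX map_polyC /= c0 addr0.
rewrite PE in SP *; rewrite IH ?mul0r // => [j|].
  by have := SP j.+1; rewrite coefMX.
have [|//|/(fn0 lt_id)//] := zirreducible_prime (p := P.[f i]) (q := f i) (irrZ lt_id).
move=> x Zx; have := PZ x Zx; rewrite !hornerE mevalD.
by rewrite ((kerE c).1 c0) ?addr0 //; apply: (chain_subset lt_id).
Qed.

(** For [i = 0] the ring consists of constants, which any single point of [Z 0] detects; the
    inductive step is [chain_relation_trivial]. *)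
Lemma chain_faithfulP i : (i <= d)%N -> chain_faithful i.
Proof.
elim: i => [|i IH] le_id a /=.
  move=> [c e] a0; have [_ [x Zx] _] := irrZ le_id.
  have := (kerE (a - c%:MP)).1; rewrite rmorphB e subrr.
  move=> /(_ erefl x (chain_subset le_id Zx)); rewrite mevalB a0 // mevalC.
  by move=> /eqP; rewrite sub0r oppr_eq0 => /eqP ->; rewrite mpolyC0 rmorph0.
case=> p Sp e a0; have [P pE] := coefs_in_lift (@chain_ring_lift i) Sp.
rewrite e pE (chain_relation_trivial le_id) ?horner0 //.
- by apply: IH; apply: ltnW.
- by rewrite -pE.
move=> x Zx; have := (kerE (a - P.[f i])).1.
rewrite rmorphB e pE horner_map subrr => /(_ erefl x (chain_subset le_id Zx)).
by rewrite mevalB a0 // sub0r => /eqP; rewrite oppr_eq0 => /eqP.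
Qed.

Lemma chain_transcendental i (p : {poly L}) : (i < d)%N ->
  coefs_in (chain_ring i) p -> p.[pr (f i)] = 0 -> p = 0.
Proof.
move=> lt_id Sp; have [P pE] := coefs_in_lift (@chain_ring_lift i) Sp.
rewrite pE horner_map => /kerE P0.
apply: (chain_relation_trivial lt_id) => [||x Zx].
- by apply: chain_faithfulP; apply: ltnW.
- by rewrite -pE.
- by apply: P0; apply: (chain_subset lt_id).
Qed.

(** This is the partial derivative in [f j]: each new [f i] is transcendental over the ring before
    it, so its value under [D] may be prescribed freely. *)
Lemma chain_derivation j i : (i <= d)%N ->
  exists D, [/\ derivation_on (chain_ring i) D,
    forall c, chain_ring i (pr c%:MP) /\ D (pr c%:MP) = 0 &
    forall k, (k < i)%N ->
      chain_ring i (pr (f k)) /\ D (pr (f k)) = (k == j)%:R].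
Proof.
elim: i => [|i IH] le_id.
  exists (fun=> 0); split=> //; last by split=> //; exists c.
  split; first exact: (chain_ring_subring 0).
  - by move=> *; rewrite addr0.
  - by move=> *; rewrite mul0r mulr0 addr0.
have [D [derD DC Df]] := IH (ltnW le_id).
have [subS _ _] := derD.
have [p|D' [derD' extD D'f]] :=
  @derivation_adjoin_transcendental L _ _ (pr (f i)) (i == j)%:R derD.
  exact: chain_transcendental.
exists D'; split=> // [c|k].
  have [Sc Dc] := DC c.
  by split; [apply: sub_adjoin|rewrite extD].
rewrite ltnS leq_eqVlt => /predU1P[->|/Df[Sk Dk]].
  by split=> //; apply: mem_adjoin.
by split; [apply: sub_adjoin|rewrite extD].
Qed.

Lemma chain_mxrank m (g : 'I_m -> {mpoly C[n]}) : [pchar L] =i pred0 ->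
  (forall k, vanishes X (g k)) ->
  (\rank (\matrix_(k < m, i < n) pr (mderiv i (g k))) + d <= n)%N.
Proof.
move=> ch0 gX.
have /choice[D DP] (j : 'I_d) : exists D : L -> L,
    (forall k : 'I_d, \sum_(i < n) pr (mderiv i (f k)) * D (pr 'X_i) = (k == j)%:R)
    /\ forall k, \sum_(i < n) pr (mderiv i (g k)) * D (pr 'X_i) = 0.
  have [D [derD DC Df]] := chain_derivation j (leqnn d).
  have [S' [D' [derD' ext memX]]] :=
    derivation_adjoin_seq [seq pr 'X_i | i : 'I_n] ch0 derD.
  have DE q : D' (pr q) = \sum_(i < n) pr (mderiv i q) * D' (pr 'X_i).
    apply: (derivation_mpoly derD' _ _ q).2 => [c|i].
      by have [/ext[? ->]] := DC c.
    by apply: memX; apply: image_f.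
  exists D'; split=> k; rewrite -DE.
    by have [/ext[_ ->]] := Df k (ltn_ord k).
  by rewrite (kerE _).2 // (derivation0 derD').
(* Column [j] is the vector field of [D j]. By the chain rule the gradients of the [f k] send [V] to
   the identity, so its rank is at least [d], while the gradients of the [g k] annihilate it. *)
pose V := \matrix_(i < n, j < d) D j (pr 'X_i).
have rkV : (d <= \rank V)%N.
  pose M := \matrix_(k < d, i < n) pr (mderiv i (f k)).
  rewrite -{1}(@mxrank1 L d) (_ : 1%:M = M *m V) ?mxrankM_maxr //.
  apply/matrixP => k j; rewrite !mxE -(DP j).1.
  by apply: eq_bigr => i _; rewrite !mxE.
pose J := \matrix_(k < m, i < n) pr (mderiv i (g k)).
have JV0 : J *m V = 0.
  apply/matrixP => k j; rewrite !mxE -[RHS]((DP j).2 k).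
  by apply: eq_bigr => i _; rewrite !mxE.
by apply: leq_trans (mulmx0_rank_max JV0); rewrite leq_add2l.
Qed.

End Chain.

(** * Conormal vectors and the row space of the Jacobian *)

Section Conormal.
Variables (C : fieldType) (n : nat) (X : pt C n -> Prop).
Variable gens : seq {mpoly C[n]}.
Hypothesis genX : generates_ideal gens X.

Lemma generator_vanishes (k : 'I_(size gens)) : vanishes X gens`_k.
Proof.
apply/genX; exists (fun i => (i == k)%:R).
rewrite (bigD1 k) //= eqxx mul1r big1 ?addr0 // => i /negPf ->.
by rewrite mul0r.
Qed.

(** In the product rule the terms that keep a generator undifferentiated vanish at [x]. *)
Lemma gradient_sub_jac g x : X x -> vanishes X g ->
  (\row_j (mderiv j g).@[x] <= jac gens x)%MS.
Proof.
move=> Xx /genX[a ->].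
have -> : \row_j (mderiv j (\sum_(k < size gens) a k * gens`_k)).@[x] =
    (\row_k (a k).@[x]) *m jac gens x; last exact: submxMl.
apply/rowP => j; rewrite !mxE (raddf_sum (mderiv j)) (raddf_sum (meval x)); apply: eq_bigr => k _.
by rewrite !mxE /= mderivM mevalD !mevalM generator_vanishes // mulr0 add0r.
Qed.

Lemma conormalP w x : X x ->
  (forall v, tangent X x v -> bform w v = 0) <->
  (\row_j w j <= jac gens x)%MS.
Proof.
move=> Xx; split=> [conw|/submxP[a /rowP wE] v tv]; last first.
  transitivity (\sum_k a 0 k * \sum_(j < n) (mderiv j gens`_k).@[x] * v j).
    under [RHS]eq_bigr do rewrite mulr_sumr.
    rewrite exchange_big; apply: eq_bigr => j _ /=.
    have := wE j; rewrite !mxE => ->; rewrite mulr_suml.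
    by apply: eq_bigr => k _; rewrite mxE mulrA.
  by rewrite big1 // => k _; rewrite tv ?mulr0 //; apply: generator_vanishes.
(* The columns of [cokermx] serve as test vectors: they are tangent because every gradient of the
   ideal lies in the row space. *)
rewrite submxE; apply/eqP/rowP => l; rewrite !mxE.
rewrite -[RHS](conw (fun j => cokermx (jac gens x) j l)).
  by apply: eq_bigr => j _; rewrite mxE.
move=> g /(gradient_sub_jac Xx); rewrite submxE => /eqP/rowP/(_ l).
rewrite mxE [RHS]mxE => e; rewrite -[RHS]e.
by apply: eq_bigr => j _; rewrite [X in _ = X * _]mxE.
Qed.

End Conormal.

(** The rank at a point is at most the rank over the function field, which a chain of length [d]
    bounds by [n - d = c]. *)
Lemma mxrank_jac_codim (C : fieldType) n (X : pt C n -> Prop) c gens x :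
  [pchar C] =i pred0 -> zirreducible X -> zcodim X c ->
  generates_ideal gens X -> X x -> (\rank (jac gens x) <= c)%N.
Proof.
move=> ch0 irrX [d [[[Z [irrZ ZS ZX]] _] dcn]] genX Xx.
have [L [pr kerE]] := function_field irrX.
have /choice[f fP] i : exists f, (i < d)%N ->
    vanishes (Z i) f /\ ~ vanishes (Z i.+1) f.
  have [lt_id|] := boolP (i < d)%N; last by exists 0.
  have [_ [y [Zy nZy]]] := ZS i lt_id.
  have [clZ _ _] := irrZ i (ltnW lt_id).
  by have [h hP] := proper_subset_separated clZ Zy nZy; exists h.
pose G := \matrix_(k < size gens, i < n) mderiv i gens`_k.
have -> : jac gens x = map_mx (meval x) G by apply/matrixP => k i; rewrite !mxE.
have leG : (\rank (map_mx (meval x) G) <= \rank (map_mx pr G))%N.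
  by apply: mxrank_map_le => a /kerE; apply.
apply: leq_trans leG _; rewrite -(leq_add2r d) [X in (_ <= X)%N]addnC dcn.
have -> : map_mx pr G = \matrix_(k < size gens, i < n) pr (mderiv i gens`_k).
  by apply/matrixP => k i; rewrite !mxE.
apply: (@chain_mxrank C n X d Z f) => //.
- by move=> i lt_id; have [] := ZS i lt_id.
- by move=> i /fP[].
- by move=> i /fP[].
- apply/pcharf0P => k.
  have -> : (k%:R : L) = (pr \o @mpolyC n C) k%:R by rewrite rmorph_nat.
  by rewrite fmorph_eq0 (pcharf0P _).1.
- exact: generator_vanishes.
Qed.

(** * Substitution, scaling and restriction of polynomials to a line *)

Lemma meval_comp_mktuple (C : fieldType) m n (h : 'I_m -> {mpoly C[n]}) p x :
  (p \mPo [tuple h i | i < m]).@[x] = p.@[fun i => (h i).@[x]].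
Proof. by rewrite comp_mpoly_meval; apply: meval_eq => i; rewrite tnth_mktuple. Qed.

Lemma meval_mderiv_scale (C : fieldType) n (t : C) (p : {mpoly C[n]}) j x :
  (mderiv j (p \mPo [tuple t *: 'X_i | i < n])).@[x] =
  t * (mderiv j p).@[fun i => t * x i].
Proof.
elim/mpoly_ring_ind: p => [c|i|p q Ep Eq|p q Ep Eq].
- by rewrite comp_mpolyC !mderivC !meval0 mulr0.
- rewrite comp_mpolyXU -tnth_nth tnth_mktuple mderivZ mevalZ; congr (_ * _).
  rewrite mderivX mnm1E !mevalZ; case: (eqVneq i j) => [->|_].
    by rewrite mnmBB mpolyX0 !meval1.
  by rewrite !mul0r.
- by rewrite comp_mpolyD !mderivD !mevalD Ep Eq mulrDr.
- rewrite rmorphM !mderivM !mevalD !mevalM Ep Eq !meval_comp_mktuple.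
  have E r : r.@[fun i => (t *: 'X_i).@[x]] = r.@[fun i => t * x i].
    by apply: meval_eq => i; rewrite mevalZ mevalXU.
  by rewrite !E; ring.
Qed.

Lemma meval_line (C : fieldType) n (p : {mpoly C[n]}) (a b : pt C n) :
  exists P : {poly C}, forall t, P.[t] = p.@[fun i => a i + t * b i].
Proof.
elim/mpoly_ring_ind: p => [c|i|p q [P EP] [Q EQ]|p q [P EP] [Q EQ]].
- by exists c%:P => t; rewrite hornerC mevalC.
- by exists ((a i)%:P + (b i) *: 'X) => t; rewrite !hornerE mevalXU mulrC.
- by exists (P + Q) => t; rewrite hornerD mevalD EP EQ.
- by exists (P * Q) => t; rewrite hornerM mevalM EP EQ.
Qed.

(** The algebraic form of letting [t] tend to 0: a nonzero [P] would have the [size P] distinct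
    roots [1, ..., size P], too many for its degree. *)
Lemma horner0_eq0 (C : numFieldType) (P : {poly C}) :
  (forall t, t != 0 -> P.[t] = 0) -> P.[0] = 0.
Proof.
move=> P0; have [->|/max_poly_roots maxP] := eqVneq P 0; first by rewrite horner0.
have : (size [seq i.+1%:R : C | i <- iota 0 (size P)] < size P)%N.
  apply: maxP.
    by apply/allP => _ /mapP[i _ ->]; apply/rootP/P0; rewrite pnatr_eq0.
  by rewrite map_inj_uniq ?iota_uniq // => i j /eqP; rewrite eqr_nat => /eqP[].
by rewrite size_map size_iota ltnn.
Qed.

Lemma join_ptl (C : fieldType) n (u x : pt C n) i : join_pt u x (lshift n i) = u i.
Proof. by rewrite /join_pt (unsplitK (inl i)). Qed.

Lemma join_ptr (C : fieldType) n (u x : pt C n) i : join_pt u x (rshift n i) = x i.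
Proof. by rewrite /join_pt (unsplitK (inr i)). Qed.

(** * Scaling on the cone and the first inclusion *)

Section Cone.
Variables (C : numFieldType) (n : nat) (X : pt C n -> Prop) (c : nat).
Variable gens : seq {mpoly C[n]}.
Hypotheses (irrX : zirreducible X) (coneX : affine_cone X).
Hypotheses (codX : zcodim X c) (genX : generates_ideal gens X).

Lemma regP x : reg X gens c x <-> X x /\ (c <= \rank (jac gens x))%N.
Proof.
split=> -[Xx rk]; split=> //; last by case=> _; rewrite ltnNge rk.
by rewrite leqNgt; apply/negP => lt_c; apply: rk.
Qed.

Lemma jac_sub_scale t x : t != 0 -> X x ->
  (jac gens x <= jac gens (fun i => (t * x i)%R))%MS.
Proof.
move=> t0 Xx; apply/row_subP => k.
(* Rescaling keeps the generator in the ideal of the cone, and the gradient of [h] at [t x] is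
   [t^-1] times that of the generator at [x]. *)
pose h := gens`_k \mPo [tuple t^-1 *: 'X_i | i < n].
have hX : vanishes X h.
  move=> y Xy; rewrite meval_comp_mktuple.
  rewrite -[RHS](generator_vanishes genX k (coneX t^-1 Xy)).
  by apply: meval_eq => i; rewrite mevalZ mevalXU.
have := gradient_sub_jac genX (coneX t Xx) hX; apply: submx_trans.
have -> : row k (jac gens x) =
    t *: \row_j (mderiv j h).@[fun i => t * x i]; last exact: scalemx_sub.
apply/rowP => j; rewrite !mxE meval_mderiv_scale mulrA divff // mul1r.
by apply: meval_eq => i; rewrite mulKf.
Qed.

(** The row space at [x] lies in the one at [t x], so [t x] stays regular and [w], the difference of
    the two points, adds no rank to a Jacobian of rank at most [c]. *)
Lemma ed_pair_conormal t x w : t != 0 -> reg X gens c x ->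
  (forall v, tangent X x v -> bform w v = 0) ->
  ed_pair X gens c (fun i => w i + t * x i) (fun i => t * x i).
Proof.
move=> t0 /regP[Xx rkx] /(conormalP genX w Xx) wJ.
have Xtx : X (fun i => t * x i) by apply: coneX.
have leJ := jac_sub_scale t0 Xx.
split; first by apply/regP; split=> //; apply: leq_trans (mxrankS leJ).
apply: leq_trans (mxrank_jac_codim (pchar_num C) irrX codX genX Xtx).
apply: mxrankS; rewrite col_mx_sub submx_refl andbT.
apply: submx_trans leJ; apply: submx_trans wJ.
by rewrite (_ : \row_j _ = \row_j w j) //; apply/rowP => j; rewrite !mxE addrK.
Qed.

Lemma dual_sub_isotropic_locus u :
  dual_variety X gens c u -> ed_isotropic_locus X gens c u.
Proof.
move=> Xu; have [_ [x0 Xx0] _] := irrX.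
(* The origin, written as a multiple of a point of [X] so that the cone property applies
   directly. *)
exists (fun i => 0 * x0 i); split; first exact: coneX.
  by rewrite /isotropic big1 // => i _; rewrite mul0r expr0n.
move=> q qE.
(* Pulling [q] back along [w |-> (w, 0)] gives a polynomial in [w], so it suffices to test it on
   conormal vectors, whose closure is the dual variety. *)
pose h (i : 'I_(n + n)) : {mpoly C[n]} := if split i is inl j then 'X_j else 0.
have hE w : (q \mPo [tuple h i | i < n + n]).@[w] =
    q.@[join_pt w (fun i => 0 * x0 i)].
  rewrite meval_comp_mktuple; apply: meval_eq => i; rewrite /h /join_pt.
  by case: (split i) => j; rewrite ?mevalXU ?meval0 ?mul0r.
rewrite -hE; apply: Xu => w [y [regy conw]]; rewrite hE.
(* The line [t |-> (w + t y, t y)] consists of ED pairs for [t != 0] and meets [(w, 0)] at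
   [t = 0]. *)
have [P PE] := meval_line q (join_pt w (fun=> 0)) (join_pt y y).
have -> : q.@[join_pt w (fun i => 0 * x0 i)] = P.[0].
  rewrite PE; apply: meval_eq => i; rewrite /join_pt.
  by case: (split i) => j; rewrite !mul0r ?addr0.
apply: horner0_eq0 => t t0; rewrite PE.
rewrite -[RHS](qE (join_pt (fun i => w i + t * y i) (fun i => t * y i))).
  apply: meval_eq => i; rewrite /join_pt.
  by case: (split i) => j; rewrite ?add0r.
by do 2!eexists; split=> //; apply: ed_pair_conormal.
Qed.

End Cone.

(** * The second inclusion and the conclusion *)

Lemma ed_corr_sub_dual (C : fieldType) n (X : pt C n -> Prop) c gens u x :
  generates_ideal gens X -> ed_corr X gens c u x ->
  dual_variety X gens c (fun i => u i - x i).
Proof.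
move=> genX ux p pX.
(* Pulling [p] back along [(u, x) |-> u - x] reduces the claim from the closure to actual ED
   pairs. *)
pose h (i : 'I_n) : {mpoly C[n + n]} := 'X_(lshift n i) - 'X_(rshift n i).
have hE v y : (p \mPo [tuple h i | i < n]).@[join_pt v y] =
    p.@[fun i => v i - y i].
  rewrite meval_comp_mktuple; apply: meval_eq => i.
  by rewrite mevalB !mevalXU join_ptl join_ptr.
rewrite -hE; apply: ux => _ [v [y [-> [regy rk]]]].
rewrite hE; apply: pX; exists y; split=> //.
have [Xy nsing] := regy.
apply/(conormalP genX _ Xy).
set r := \row_j _ in rk *; set J := jac gens y in rk *.
have leJ : (J <= col_mx r J)%MS.
  by have := submx_refl (col_mx r J); rewrite col_mx_sub => /andP[].
have rJ : (c <= \rank J)%N.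
  by rewrite leqNgt; apply/negP => lt_c; apply: nsing.
(* Regularity gives [J] rank at least [c], and the extended matrix has rank at most [c]; the row
   spaces are nested, hence equal. *)
have : (col_mx r J <= J)%MS.
  rewrite -(mxrank_leqif_sup leJ) eqn_leq mxrankS //=.
  exact: leq_trans rk rJ.
by rewrite col_mx_sub => /andP[].
Qed.

Theorem theorem2p2 (R : realType) (n : nat) (X : pt R[i] n -> Prop) (c : nat)
    (gens : seq {mpoly R[i][n]}) :
  zirreducible X -> affine_cone X -> zcodim X c -> generates_ideal gens X ->
  (forall u, dual_variety X gens c u -> ed_isotropic_locus X gens c u) /\
  (forall u, ed_isotropic_locus X gens c u ->
     exists a b : pt R[i] n,
       [/\ dual_variety X gens c a, X b, isotropic b & forall j, u j = a j + b j]).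
Proof.
move=> irrX coneX codX genX; split=> [u|u [x [Xx isox ux]]].
  exact: dual_sub_isotropic_locus.
(* The isotropic point [x] over [u] itself serves as the summand [b]. *)
exists (fun i => u i - x i), x; split=> //; last by move=> j; rewrite subrK.
exact: ed_corr_sub_dual.
Qed.
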